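(* Let $N\ge 2$, let $G\in\mathbb{R}^{N\times N}$ be the lifted system matrix described in the context, let $r\in\mathbb{R}^N$, let $\lambda>0$, let $\mathcal{U}\subset\mathbb{R}^N$ be a nonempty compact convex set, and let $T\in\mathbb{R}^{(N-1)\times N}$ be the difference matrix $(Tu)_i=u_{i+1}-u_i$, $i=1,\dots,N-1$. Let $\{u_k\}_{k\ge 0}$ be the sequence generated by the gradient-based sparse iterative learning control (S-ILC) algorithm described in the context, and let $$F(u):=\frac12\Vert Gu-r\Vert^2+\lambda\Vert Tu\Vert_1 .$$ Then the sequence of functional values $F(u_k)$ is non-increasing; that is, for all $k\ge 1$, $$F(u_{k+1})\le F(u_k).$$
   Context: $\Vert\cdot\Vert$ is the Euclidean norm, $\Vert\cdot\Vert_1$ the $\ell_1$ norm, and $\rho(M)$ the spectral radius of a real square matrix $M$. Lifted system matrix: for a stable discrete-time single-input single-output linear time-invariant system $x[t+1]=Ax[t]+Bu[t]$, $y[t]=Cx[t]$, $x[0]=0$, of relative degree $t^*>0$ (so $CA^{j}B=0$ for $0\le j<t^*-1$ and $CA^{t^*-1}B\neq 0$), and a finite trial length $\mathrm{T}$ (a positive integer, not to be confused with the difference matrix $T$), put $N=\mathrm{T}-t^*+1$. $G\in\mathbb{R}^{N\times N}$ is the lower triangular Toeplitz matrix with $G_{ij}=CA^{t^*-1+i-j}B$ for $i\ge j$ and $G_{ij}=0$ for $i<j$. The output on a trial with input $u\in\mathbb{R}^N$ is $y=Gu$ and the tracking error is $e=r-Gu$, where $r$ is the reference trajectory. S-ILC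 algorithm (no modeling error, proximal step computed exactly): set $\gamma=1/\rho(G^\top G)$, $u_0=0$, $e_0=0$. For $k=1,2,\dots$: $$b_k=u_{k-1}+\gamma G^\top e_{k-1},\qquad u_k=\underset{u\in\mathcal{U}}{\mathrm{argmin}}\ \Big\{\gamma\lambda\Vert Tu\Vert_1+\frac12\Vert u-b_k\Vert^2\Big\},\qquad e_k=r-Gu_k .$$ *)

(* Defs.v *)
From mathcomp Require Import all_boot all_order all_algebra.
From mathcomp Require Import all_classical all_reals all_analysis.
From mathcomp Require Import complex.

Set Implicit Arguments.
Unset Strict Implicit.
Unset Printing Implicit Defensive.

Import Order.TTheory GRing.Theory Num.Theory.
Import numFieldNormedType.Exports.

Local Open Scope classical_set_scope.
Local Open Scope ring_scope.

Section Vectors.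
Variable R : realType.

(* The library norm on matrices is the max norm; these are the l1 norm and the
   Euclidean norm. *)
Definition norm1 n (v : 'cV[R]_n) : R := \sum_i `|v i 0|.
Definition norm2 n (v : 'cV[R]_n) : R := Num.sqrt (\sum_i v i 0 ^+ 2).

(* Eigenvalues are taken in R[i]. The set is finite, so the supremum is a
   maximum; it is 0 by convention when n = 0. *)
Definition spectral_radius n (M : 'M[R]_n) : R :=
  sup [set ComplexField.Normc.normc z
      | z in [set z : R[i] | eigenvalue (map_mx (real_complex R) M) z]].

Definition argmin (V : Type) (U : set V) (f : V -> R) : set V :=
  [set u | U u /\ forall v, U v -> f u <= f v].

(* (diff_mx N *m u) i 0 is the difference of the entries i.+1 and i of u. *)
Definition diff_mx N : 'M[R]_(N.-1, N) :=
  \matrix_(i, j) ((j == i.+1 :> nat)%:R - (j == i :> nat)%:R).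

End Vectors.

Section System.
Variables (R : realType) (n : nat).
Implicit Types (A : 'M[R]_n) (B : 'cV[R]_n) (C : 'rV[R]_n).

(* Schur stability, i.e. asymptotic stability in discrete time. *)
Definition stable A := spectral_radius A < 1.

Definition markov A B C (j : nat) : R := (C *m A ^+ j *m B) 0 0.

Definition relative_degree A B C (t : nat) : Prop :=
  [/\ (0 < t)%N,
      forall j, (j < t.-1)%N -> markov A B C j = 0 &
      markov A B C t.-1 != 0].

(* Both subtractions are exact: t > 0 for a relative degree t, and j <= i in the
   branch where i - j occurs. *)
Definition lifted_mx A B C (t N : nat) : 'M[R]_N :=
  \matrix_(i, j) if (j <= i)%N then markov A B C (t.-1 + (i - j)) else 0.

End System.

Section Algorithm.
Variables (R : realType) (N : nat).
Implicit Types (G : 'M[R]_N) (r u v b : 'cV[R]_N) (U : set 'cV[R]_N).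

Definition step_size G : R := (spectral_radius (G^T *m G))^-1.

Definition prox_objective G (lambda : R) b u : R :=
  step_size G * lambda * norm1 (diff_mx R N *m u) + 2^-1 * norm2 (u - b) ^+ 2.

(* The run starts from e_0 = 0, not from r - G u_0. *)
Definition silc G r (lambda : R) U (u e b : nat -> 'cV[R]_N) : Prop :=
  [/\ u 0%N = 0, e 0%N = 0 &
      forall k, (0 < k)%N ->
        [/\ b k = u k.-1 + step_size G *: (G^T *m e k.-1),
            argmin U (prox_objective G lambda (b k)) (u k) &
            e k = r - G *m u k]].

Definition objective G r (lambda : R) u : R :=
  2^-1 * norm2 (G *m u - r) ^+ 2 + lambda * norm1 (diff_mx R N *m u).

End Algorithm.

(* Main.v *)
(* The proximal step minimises the majorant of F at the previous iterate obtained
   by replacing |G d|^2 with gamma^-1 |d|^2; the majorisation holds because the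
   spectral radius of G^T G bounds its Rayleigh quotient. The step size is positive since
   the diagonal of G is a nonzero Markov parameter. *)

Require Import Defs.
From mathcomp Require Import all_boot all_order all_algebra.
From mathcomp Require Import all_classical all_reals all_analysis.
From mathcomp Require Import complex ring lra.

Set Implicit Arguments.
Unset Strict Implicit.
Unset Printing Implicit Defensive.

Import Order.TTheory GRing.Theory Num.Theory.
Import numFieldNormedType.Exports.

Local Open Scope classical_set_scope.
Local Open Scope ring_scope.

Section NumericalRange.
Variable C : numClosedFieldType.
Local Open Scope sesquilinear_scope.

Lemma conj_mul_cV_diag n (d : 'rV[C]_n) (y : 'cV[C]_n) :
  (y^t* *m diag_mx d *m y) 0 0 = \sum_i d 0 i * `|y i 0| ^+ 2.
Proof.
rewrite mxE; apply: eq_bigr => i _.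
by rewrite mul_mx_diag !mxE normCK; ring.
Qed.

Lemma conj_mul_cV n (y : 'cV[C]_n) : (y^t* *m y) 0 0 = \sum_i `|y i 0| ^+ 2.
Proof. by rewrite mxE; apply: eq_bigr => i _; rewrite !mxE normCK mulrC. Qed.

(** In the unitary eigenbasis, with [y = P *m x], the form is the sum of the [|y_i|^2] weighted by
    the eigenvalues, while unitarity makes the unweighted sum equal to [x^t* *m x]. The triangle
    inequality then compares the two. *)
Lemma normalmx_quadratic_le n (A : 'M[C]_n) (c : C) (x : 'cV[C]_n) :
  A \is normalmx -> (forall z, eigenvalue A z -> `|z| <= c) ->
  `|(x^t* *m A *m x) 0 0| <= c * (x^t* *m x) 0 0.
Proof.
move=> /orthomx_spectralP; set P := spectralmx A; set d := spectral_diag A.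
move=> AE cA; have Pu : P \is unitarymx by exact: spectral_unitarymx.
have Pinv := invmx_unitary Pu.
(* Eigenvectors are row vectors here, so row [i] of [P] is the witness for [d 0 i]. *)
have dA i : eigenvalue A (d 0 i).
  apply/eigenvalueP; exists (row i P).
    rewrite {1}AE !mulmxA -row_mul mulmxV ?spectral_unit // row1 -rowE.
    by rewrite row_diag_mx -scalemxAl -rowE.
  apply/eqP; rewrite rowE => /(canRL (mulmxK (spectral_unit A))) /rowP /(_ i).
  by rewrite mul0mx !mxE !eqxx => /eqP; rewrite oner_eq0.
have yE : (P *m x)^t* = x^t* *m P^t* by rewrite trmx_mul map_mxM.
have -> : x^t* *m A *m x = (P *m x)^t* *m diag_mx d *m (P *m x).
  by rewrite yE AE Pinv !mulmxA.
have -> : x^t* *m x = (P *m x)^t* *m (P *m x).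
  by rewrite yE mulmxA mulmxKtV.
rewrite conj_mul_cV_diag conj_mul_cV mulr_sumr.
apply: le_trans (ler_norm_sum _ _ _) _; apply: ler_sum => i _.
by rewrite normrM normrX normr_id ler_wpM2r ?exprn_ge0 // cA.
Qed.

End NumericalRange.

Section SpectralRadius.
Variable R : realType.

Lemma norm2_sqr n (x : 'cV[R]_n) : norm2 x ^+ 2 = (x^T *m x) 0 0.
Proof.
rewrite sqr_sqrtr; first by rewrite mxE; apply: eq_bigr => i _; rewrite mxE.
by apply: sumr_ge0 => i _; exact: sqr_ge0.
Qed.

Lemma norm2_gt0 n (x : 'cV[R]_n) : x != 0 -> 0 < norm2 x.
Proof.
move=> x0; rewrite sqrtr_gt0 lt_def sumr_ge0 ?andbT; last first.
  by move=> i _; exact: sqr_ge0.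
apply: contra x0; rewrite psumr_eq0 => [|i _]; last exact: sqr_ge0.
move=> /allP xi0; apply/eqP/colP => i; rewrite mxE; apply/eqP.
by have := xi0 i (mem_index_enum i); rewrite /= sqrf_eq0.
Qed.

Lemma norm2_sqrD n (x y : 'cV[R]_n) :
  norm2 (x + y) ^+ 2 = norm2 x ^+ 2 + 2 * (x^T *m y) 0 0 + norm2 y ^+ 2.
Proof.
have yx : (y^T *m x) 0 0 = (x^T *m y) 0 0.
  by rewrite -{1}[x]trmxK -trmx_mul mxE.
rewrite !norm2_sqr [(x + y)^T]linearD /= mulmxDl !mulmxDr ![(_ + _ : 'M[R]_1) 0 0]mxE yx.
ring.
Qed.

Lemma spectral_radius_ub n (M : 'M[R]_n) (z : R[i]) :
  eigenvalue (map_mx (real_complex R) M) z ->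
  `|z| <= (spectral_radius M)%:C%C.
Proof.
set Mc := map_mx _ _ => Mz; rewrite normc_def lecR.
apply: ub_le_sup; last by exists z => //; case: z {Mz}.
have [s sE] := closed_field_poly_normal (char_poly Mc).
(* The supremum dominates its members only if the set is bounded above. Every eigenvalue is a root
   of the characteristic polynomial, so the sum of the moduli of all roots is a bound. *)
exists (\sum_(w <- s) ComplexField.Normc.normc w) => _ [w Mw <-].
have ws : w \in s.
  move: Mw; rewrite /= eigenvalue_root_char sE (monicP (char_poly_monic _)).
  by rewrite scale1r root_prod_XsubC.
have normc_ge0 (a : R[i]) : 0 <= ComplexField.Normc.normc a.
  by case: a => ? ?; exact: sqrtr_ge0.
by rewrite (big_rem w ws) /= lerDl sumr_ge0.
Qed.

(** Over [R[i]] a real symmetric matrix equals its conjugate transpose, hence is normal. Its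
    quadratic form at a real vector is real, so it is at most its own modulus. *)
Lemma symmetric_rayleigh_le n (M : 'M[R]_n) (x : 'cV[R]_n) :
  M^T = M -> (x^T *m M *m x) 0 0 <= spectral_radius M * norm2 x ^+ 2.
Proof.
move=> Msym; set f := real_complex R; set Mc := map_mx f M.
have conjf m p (B : 'M[R]_(m, p)) : map_mx Num.conj (map_mx f B) = map_mx f B.
  by apply/matrixP => i j; rewrite !mxE; apply/CrealP/complex_realP; exists (B i j).
have Mn : Mc \is normalmx.
  by apply/normalmxP; rewrite /Mc map_trmx Msym conjf.
have := normalmx_quadratic_le (map_mx f x) Mn (@spectral_radius_ub _ M).
rewrite map_trmx conjf -!map_mxM ![map_mx f _ 0 0]mxE norm2_sqr -rmorphM.
by move=> /(le_trans (real_ler_norm _)); rewrite lecR; apply;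
  apply/complex_realP; eexists.
Qed.

Lemma norm2_mul_sqr_le m n (G : 'M[R]_(m, n)) (x : 'cV[R]_n) :
  norm2 (G *m x) ^+ 2 <= spectral_radius (G^T *m G) * norm2 x ^+ 2.
Proof.
rewrite norm2_sqr trmx_mul mulmxA -[X in X *m x]mulmxA.
by apply: symmetric_rayleigh_le; rewrite trmx_mul trmxK.
Qed.

(** A basis vector that selects a nonzero column of [G] makes the left side of the Rayleigh bound
    positive. *)
Lemma spectral_radius_gram_gt0 m n (G : 'M[R]_(m, n)) :
  G != 0 -> 0 < spectral_radius (G^T *m G).
Proof.
move=> G0; have [j Gj0] : exists j, col j G != 0.
  apply/existsP; apply: contraNT G0; rewrite negb_exists => /forallP Gj.
  apply/eqP/matrixP => i j; have /negPn/eqP/colP/(_ i) := Gj j.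
  by rewrite !mxE.
have := norm2_mul_sqr_le G (delta_mx j 0); rewrite -colE.
move=> /(lt_le_trans (exprn_gt0 2 (norm2_gt0 Gj0))).
by rewrite pmulr_lgt0 // exprn_gt0 // norm2_gt0 //; apply/eqP => /colP/(_ j)/eqP;
  rewrite !mxE !eqxx oner_eq0.
Qed.

End SpectralRadius.

Lemma prox_step_objective_le (R : realType) N (G : 'M[R]_N) (r v u : 'cV[R]_N)
    (lambda : R) (U : set 'cV[R]_N) :
  G != 0 -> U v ->
  argmin U (prox_objective G lambda
    (v + step_size G *: (G^T *m (r - G *m v)))) u ->
  objective G r lambda u <= objective G r lambda v.
Proof.
move=> G0 Uv [_ /(_ _ Uv)]; rewrite /prox_objective /objective.
have gamma_gt0 : 0 < step_size G.
  by rewrite invr_gt0; exact: spectral_radius_gram_gt0.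
set gamma := step_size G in gamma_gt0 *.
set g := G^T *m _; set d := u - v.
have -> : u - (v + gamma *: g) = d + - (gamma *: g) by rewrite opprD addrA.
(* The added [0] lets both proximal distances expand by [norm2_sqrD]; their common term, the squared
   norm of [gamma *: g], then cancels. *)
have -> : v - (v + gamma *: g) = 0 + - (gamma *: g).
  by rewrite opprD addrA subrr.
have -> : G *m u - r = G *m d + (G *m v - r).
  by rewrite mulmxBr addrA subrK.
(* The gradient of the quadratic term at [v] is [- g]. *)
have Gdg : ((G *m d)^T *m (G *m v - r)) 0 0 = - (d^T *m g) 0 0.
  by rewrite trmx_mul -mulmxA -[G *m v - r]opprB !mulmxN [LHS]mxE.
have dg : (d^T *m - (gamma *: g)) 0 0 = - gamma * (d^T *m g) 0 0.
  by rewrite mulmxN -scalemxAr ![LHS]mxE mulNr [in LHS]mxE.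
have norm20 : norm2 (0 : 'cV[R]_N) ^+ 2 = 0 by rewrite norm2_sqr mulmx0 mxE.
rewrite (norm2_sqrD d) (norm2_sqrD 0) (norm2_sqrD (G *m d)) Gdg dg norm20 trmx0 mul0mx [(0 : 'M[R]_1) 0 0]mxE => prox_le.
have Gd_le : gamma * norm2 (G *m d) ^+ 2 <= norm2 d ^+ 2.
  by rewrite -ler_pdivlMl // /gamma invrK; exact: norm2_mul_sqr_le.
(* Scaling by [gamma] gives the goal the same monomials as [prox_le] and [Gd_le], in which it is
   linear. *)
rewrite -(ler_pM2l gamma_gt0); lra.
Qed.

Lemma lifted_mx_neq0 (R : realType) n (A : 'M[R]_n) (B : 'cV[R]_n)
    (C : 'rV[R]_n) t N :
  relative_degree A B C t -> (0 < N)%N -> lifted_mx A B C t N != 0.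
Proof.
move=> [_ _ h0] N0; apply/eqP => /matrixP /(_ (Ordinal N0) (Ordinal N0)) /eqP.
by rewrite !mxE leqnn subnn addn0 (negbTE h0).
Qed.

Theorem lemma3 (R : realType)
    (n : nat) (A : 'M[R]_n) (B : 'cV[R]_n) (C : 'rV[R]_n)
    (hA : stable A)
    (t : nat) (ht : relative_degree A B C t)
    (trial : nat) (htrial : (0 < trial)%N)
    (N : nat) (hN : N = (trial - t + 1)%N) (hN2 : (2 <= N)%N)
    (G : 'M[R]_N) (hG : G = lifted_mx A B C t N)
    (r : 'cV[R]_N) (lambda : R) (hlambda : 0 < lambda)
    (U : set 'cV[R]_N) (hU0 : U !=set0) (hUcompact : compact U)
    (hUconvex : convex_set U)
    (u e b : nat -> 'cV[R]_N) (hrun : silc G r lambda U u e b) :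
  forall k : nat, (1 <= k)%N ->
    objective G r lambda (u k.+1) <= objective G r lambda (u k).
Proof.
(* From index 1 on, the iterate lies in [U], so it can compete in the next proximal step, and [e] is
   its true residual, unlike the initial [e 0 = 0]. *)
move=> [//|k] _; case: hrun => _ _ run.
have [_ [Uu _] eE] := run k.+1 isT; have [bE + _] := run k.+2 isT.
rewrite bE /= eE; apply: prox_step_objective_le => //.
by rewrite hG; apply: lifted_mx_neq0 => //; exact: leq_trans hN2.
Qed.
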